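(* Let $a=a(n)$ be a positive integer (a function of $n$), and consider the $(a:b)$ Maker-Breaker connectivity game on $K_n$ with Breaker moving first. (i) If $a=o\left(\sqrt{\frac{n}{\ln n}}\right)$, then the asymptotically optimal threshold bias for the connectivity game is $\frac{an}{a+\ln n}$. (ii) If $a=\Omega\left(\sqrt{\frac{n}{\ln n}}\right)$, then the asymptotically optimal threshold bias for the connectivity game is $n$.
   Context: The $(a:b)$ Maker-Breaker connectivity game on $K_n$: the board is the edge set of the complete graph $K_n$ on $n$ vertices. In each round Breaker first claims $b$ previously unclaimed edges, then Maker claims $a$ previously unclaimed edges (if fewer edges remain, a player claims all remaining ones). Maker wins if at the end of the game his edges contain a connected spanning subgraph of $K_n$ (equivalently a spanning tree); otherwise Breaker wins. A function $\beta(n)$ is the asymptotically optimal threshold bias if for every $\varepsilon>0$ there is $n_0$ such that for every $n\ge n_0$: Maker has a winning strategy for every positive integer $b\le(1-\varepsilon)\beta(n)$, and Breaker has a winning strategy for every integer $b\ge(1+\varepsilon)\beta(n)$. *)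

(* Defs.v *)
From mathcomp Require Import all_boot all_order all_algebra.
From mathcomp Require Import reals.

Set Implicit Arguments.
Unset Strict Implicit.
Unset Printing Implicit Defensive.

Import Order.TTheory GRing.Theory Num.Theory.

Section MakerBreaker.
Variables (T : finType) (X : {set T}).

(* The sequence of moves played so far, each of them the set of elements of the
   board X claimed in that move: Breaker, who starts, made the moves of even
   index and Maker those of odd index. *)
Definition history := seq {set T}.

Definition claimed (h : history) : {set T} := \bigcup_(i < size h) nth set0 h i.

Definition maker_part (h : history) : {set T} :=
  \bigcup_(i < size h | odd i) nth set0 h i.

Definition unclaimed (h : history) : {set T} := X :\: claimed h.

Definition strategy := history -> {set T}.

Definition legal_strategy (q : nat) (s : strategy) : Prop :=
  forall h : history,
    s h \subset unclaimed h /\ #|s h| = minn q #|unclaimed h|.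

Fixpoint play (sM sB : strategy) (k : nat) : history :=
  if k is k'.+1 then
    let h := play sM sB k' in rcons h (if odd k' then sM h else sB h)
  else [::].

Definition maker_wins_play (W : {set T} -> Prop) (sM sB : strategy) : Prop :=
  exists k, unclaimed (play sM sB k) = set0 /\ W (maker_part (play sM sB k)).

Definition maker_has_winning_strategy (a b : nat) (W : {set T} -> Prop) : Prop :=
  exists2 sM, legal_strategy a sM &
    forall sB, legal_strategy b sB -> maker_wins_play W sM sB.

Definition breaker_has_winning_strategy (a b : nat) (W : {set T} -> Prop) : Prop :=
  exists2 sB, legal_strategy b sB &
    forall sM, legal_strategy a sM -> ~ maker_wins_play W sM sB.

End MakerBreaker.

Definition complete_graph (n : nat) : {set {set 'I_n}} :=
  [set e : {set 'I_n} | #|e| == 2].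

Definition connected_spanning (n : nat) (S : {set {set 'I_n}}) : Prop :=
  forall x y : 'I_n, connect [rel u v | [set u; v] \in S] x y.

Definition contains_connected_spanning (n : nat) (M : {set {set 'I_n}}) : Prop :=
  exists2 S : {set {set 'I_n}}, S \subset M & connected_spanning S.

Definition maker_wins_connectivity (n a b : nat) : Prop :=
  maker_has_winning_strategy (complete_graph n) a b
    (@contains_connected_spanning n).

Definition breaker_wins_connectivity (n a b : nat) : Prop :=
  breaker_has_winning_strategy (complete_graph n) a b
    (@contains_connected_spanning n).

Local Open Scope ring_scope.

Definition asymptotically_optimal_threshold_bias (R : realType)
    (a : nat -> nat) (beta : nat -> R) : Prop :=
  forall eps : R, 0 < eps -> exists n0 : nat, forall n : nat, (n0 <= n)%N ->
    (forall b : nat, (0 < b)%N -> b%:R <= (1 - eps) * beta n ->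
       maker_wins_connectivity n (a n) b) /\
    (forall b : nat, (1 + eps) * beta n <= b%:R ->
       breaker_wins_connectivity n (a n) b).

(* Main.v *)
(* Maker keeps one active vertex per component of his graph.  With each edge he
   merges the component of the active vertex of largest Breaker degree into
   another one, and that vertex stops being active.  Let g(J) be the number of
   Breaker's edges touching a set J of active vertices.  Averaging over J and the
   a vertices deactivated in one turn bounds g(J) / |J| by
   (g(J') + b) / |J'| + a for some J' of size |J| + a, one turn earlier.  Hence
   g(J) / |J| stays below a potential close to (b / a) ln (n / |J|); this starts
   from sets J of size linear in n, where the total number of Breaker's edges, at
   most b n / a, is a good enough bound.  For |J| = 1 it keeps the Breaker degree
   of every active vertex below b (1 + ln n / a) + o(n) < n, and then Breaker
   cannot own all the edges between a component and its complement.

   Breaker first builds a clique of about a n^(1 - eps/2) vertices untouched by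
   Maker; afterwards each edge of Maker meets at most one of them.  He then
   spreads his edges evenly over the stars of the surviving clique vertices, of
   which a are lost per round, and fills the last star as soon as
   b + sum_j b / (1 + a j), roughly b (1 + ln n / a), exceeds n.

   When a is much larger than ln n, the threshold is n: Maker uses only a
   multiple of ln n edges per turn on purpose, and for b >= n - 1 Breaker isolates
   a vertex in his first move. *)

Require Import Defs.
From mathcomp Require Import all_boot all_order all_algebra.
From mathcomp Require Import boolp zify ring lra.

Import Order.TTheory GRing.Theory Num.Theory.

(** * Strategies from invariants *)

Set Implicit Arguments.
Unset Strict Implicit.

Lemma bigcup_rcons (T : finType) (p : pred nat) (h : seq {set T}) (S : {set T}) :
  \bigcup_(i < size (rcons h S) | p i) nth set0 (rcons h S) i =
  (\bigcup_(i < size h | p i) nth set0 h i) :|: (if p (size h) then S else set0).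
Proof.
rewrite -!(big_mkord p) size_rcons big_mkcond big_nat_recr //= [in RHS]big_mkcond.
rewrite nth_rcons ltnn eqxx; congr (_ :|: _).
by apply: eq_big_nat => i /andP[_ ltih]; rewrite nth_rcons ltih.
Qed.

Lemma leq_card_bigcup (I T : finType) (A : {pred I}) (F : I -> {set T}) :
  #|\bigcup_(i in A) F i| <= \sum_(i in A) #|F i|.
Proof.
elim/big_rec2: _ => [|i m S _ leSm]; first by rewrite cards0.
by apply: leq_trans (leq_card_setU _ _) _; rewrite leq_add2l.
Qed.

Section Strategies.
Variables (T : finType) (X : {set T}).

Definition breaker_part (h : history T) : {set T} :=
  \bigcup_(i < size h | ~~ odd i) nth set0 h i.

Lemma claimedE (h : history T) : claimed h = maker_part h :|: breaker_part h.
Proof. by rewrite /claimed (bigID (fun i : 'I__ => odd i)). Qed.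

Lemma size_play (sM sB : strategy T) (k : nat) : size (play sM sB k) = k.
Proof. by elim: k => //= k IHk; rewrite size_rcons IHk. Qed.

(** Padding a move to its exact legal size, so that a strategy only has to name the edges it cares
    about. With [S = set0] it also picks a subset of prescribed size. *)
Lemma legal_extension (U S : {set T}) (q : nat) : S \subset U -> #|S| <= q ->
  exists S' : {set T}, [/\ S \subset S', S' \subset U & #|S'| = minn q #|U|].
Proof.
move=> sSU; move: {2}(q - #|S|) (erefl (q - #|S|)) => m.
elim: m S sSU => [|m IHm] S sSU Em leSq.
  have Eq : #|S| = q by apply/eqP; rewrite eqn_leq leSq -subn_eq0 Em.
  exists S; split=> //; rewrite (minn_idPl _) // -Eq.
  exact: subset_leq_card.
have [ltSU | leUS] := ltnP #|S| #|U|; last first.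
  have ES : S = U by apply/eqP; rewrite eqEcard sSU.
  exists S; split=> //; rewrite (minn_idPr _) -?ES //.
have /subsetPn[x xU xS] : ~~ (U \subset S).
  by apply/negP => /subset_leq_card; rewrite leqNgt ltSU.
have Ec : #|x |: S| = #|S|.+1 by rewrite cardsU1 xS.
have [|||S' [sS' S'U cS']] := IHm (x |: S).
- by rewrite subUset sub1set xU.
- by rewrite Ec subnS Em.
- by rewrite Ec -subn_gt0 Em.
exists S'; split=> //; apply: subset_trans sS'; exact: subsetU1.
Qed.

Variables (a b : nat) (W : {set T} -> Prop) (P : {set T} -> {set T} -> Prop).

Lemma maker_part_play (sM sB : strategy T) (k : nat) :
  let h := play sM sB k in
  maker_part (play sM sB k.+1) = maker_part h :|: (if odd k then sM h else set0).
Proof. by move=> h; rewrite /maker_part /= bigcup_rcons size_play; case: odd. Qed.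

Lemma breaker_part_play (sM sB : strategy T) (k : nat) :
  let h := play sM sB k in
  breaker_part (play sM sB k.+1) = breaker_part h :|: (if odd k then set0 else sB h).
Proof.
by move=> h; rewrite /breaker_part /= (bigcup_rcons (predC odd)) size_play /=; case: odd.
Qed.

(** [P] describes the positions in which Breaker is to move. Monotonicity in Maker's edges absorbs
    the padding of his moves. *)
Lemma maker_wins_by_invariant : 0 < b -> P set0 set0 ->
  (forall M M' B : {set T}, M \subset M' -> P M B -> P M' B) ->
  (forall M B S : {set T}, P M B -> S \subset X :\: (M :|: B) -> #|S| <= b ->
     exists S' : {set T}, [/\ S' \subset X :\: (M :|: (B :|: S)), #|S'| <= a
                            & P (M :|: S') (B :|: S)]) ->
  (forall M B : {set T}, P M B -> X \subset M :|: B -> W M) ->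
  maker_has_winning_strategy X a b W.
Proof.
move=> b_gt0 P0 Pmono Pstep Pfinal.
(* The choice is made for all histories, reached or not: wherever some move restores [P], one that
   does is taken. *)
have /choice[sM sMP] : forall h : history T, exists S : {set T},
    (S \subset unclaimed X h /\ #|S| = minn a #|unclaimed X h|) /\
    ((exists2 S' : {set T}, S' \subset unclaimed X h /\ #|S'| <= a &
        P (maker_part h :|: S') (breaker_part h)) ->
     P (maker_part h :|: S) (breaker_part h)).
  move=> h; have [[S' [sS' cS'] PS']|noS'] := pselect (exists2 S' : {set T},
      S' \subset unclaimed X h /\ #|S'| <= a &
      P (maker_part h :|: S') (breaker_part h)).
    have [S [sS'S sS cS]] := legal_extension sS' cS'.
    by exists S; split=> // _; apply: Pmono PS'; apply: setUS.
  have [||S [_ sS cS]] := @legal_extension (unclaimed X h) set0 a.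
  - exact: sub0set.
  - by rewrite cards0.
  by exists S.
exists sM => [h|sB sBl]; first by case: (sMP h).
pose h k := play sM sB k.
have inv i : P (maker_part (h i.*2)) (breaker_part (h i.*2)).
  elim: i => [|i IHi].
    by rewrite /h /maker_part /breaker_part /= !big_ord0.
  rewrite doubleS; have oddi : odd i.*2 = false by rewrite odd_double.
  have EM : maker_part (h i.*2.+1) = maker_part (h i.*2).
    by rewrite maker_part_play oddi setU0.
  have EB : breaker_part (h i.*2.+1) = breaker_part (h i.*2) :|: sB (h i.*2).
    by rewrite breaker_part_play oddi.
  have -> : maker_part (h i.*2.+2) = maker_part (h i.*2.+1) :|: sM (h i.*2.+1).
    by rewrite maker_part_play -[odd _]/(~~ odd i.*2) oddi.
  have -> : breaker_part (h i.*2.+2) = breaker_part (h i.*2.+1).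
    by rewrite breaker_part_play -[odd _]/(~~ odd i.*2) oddi setU0.
  have [_] := sMP (h i.*2.+1); apply.
  have [sS cS] := sBl (h i.*2).
  have [||S' [sS' cS' PS']] := Pstep _ _ (sB (h i.*2)) IHi.
  - by rewrite -claimedE.
  - by rewrite cS geq_minl.
  by exists S'; rewrite ?EM ?EB // /unclaimed claimedE EM EB.
(* Breaker claims at least one edge per round while any is left, so the board is full after [#|X|]
   rounds. *)
have decr i : #|unclaimed X (h i.*2)| <= #|X| - i.
  elim: i => [|i IHi]; first by rewrite subn0 subset_leq_card ?subsetDl.
  have [sS cS] := sBl (h i.*2).
  have sub : unclaimed X (h i.+1.*2) \subset unclaimed X (h i.*2) :\: sB (h i.*2).
    rewrite /unclaimed setDDl setDS // !claimedE doubleS maker_part_play.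
    rewrite breaker_part_play /= maker_part_play breaker_part_play odd_double /=.
    rewrite !setU0; apply/subsetP => x; rewrite !inE.
    by case/orP=> [/orP[->|->]|->]; rewrite ?orbT.
  apply: leq_trans (subset_leq_card sub) _.
  rewrite cardsD (setIidPr sS) cS subnS.
  have [-> //|n0] := posnP #|unclaimed X (h i.*2)|.
  rewrite -subn1; apply: leq_sub; first exact: IHi.
  by rewrite leq_min b_gt0.
exists (#|X|.*2); have U0 : unclaimed X (h #|X|.*2) = set0.
  by apply/eqP; rewrite -cards_eq0 -leqn0 -[0](subnn #|X|) decr.
split=> //; apply: Pfinal (inv #|X|) _.
by rewrite -claimedE -setD_eq0; apply/eqP.
Qed.

(** Again [P] concerns positions with Breaker to move, and now his own padding must be harmless. As
    [P] excludes [W] at every stage, the length of the play does not matter. *)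
Lemma breaker_wins_by_invariant : P set0 set0 ->
  (forall M B B' : {set T}, B \subset B' -> P M B -> P M B') ->
  (forall M B : {set T}, P M B ->
     exists S : {set T}, [/\ S \subset X :\: (M :|: B), #|S| <= b
       & forall S' : {set T}, S' \subset X :\: (M :|: (B :|: S)) -> #|S'| <= a ->
           P (M :|: S') (B :|: S)]) ->
  (forall M B : {set T}, P M B -> ~ W M) ->
  breaker_has_winning_strategy X a b W.
Proof.
move=> P0 Pmono Pstep Pfinal.
pose good (M B S : {set T}) := forall S' : {set T},
  S' \subset X :\: (M :|: (B :|: S)) -> #|S'| <= a -> P (M :|: S') (B :|: S).
have /choice[sB sBP] : forall h : history T, exists S : {set T},
    (S \subset unclaimed X h /\ #|S| = minn b #|unclaimed X h|) /\
    (P (maker_part h) (breaker_part h) -> good (maker_part h) (breaker_part h) S).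
  move=> h; have [PMB|nP] := pselect (P (maker_part h) (breaker_part h)).
    have [S1 [sS1 cS1 gS1]] := Pstep _ _ PMB.
    rewrite -claimedE in sS1.
    have [S [sS1S sS cS]] := legal_extension sS1 cS1.
    exists S; split=> // _ S' sS' cS'.
    apply: Pmono (setUS _ sS1S) _; apply: gS1 => //.
    by apply: subset_trans sS' _; rewrite setDS // setUS // setUS.
  have [||S [_ sS cS]] := @legal_extension (unclaimed X h) set0 b.
  - exact: sub0set.
  - by rewrite cards0.
  by exists S.
exists sB => [h|sM sMl]; first by case: (sBP h).
pose h k := play sM sB k.
have inv i : P (maker_part (h i.*2)) (breaker_part (h i.*2)).
  elim: i => [|i IHi].
    by rewrite /h /maker_part /breaker_part /= !big_ord0.
  rewrite doubleS; have oddi : odd i.*2 = false by rewrite odd_double.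
  have EM : maker_part (h i.*2.+1) = maker_part (h i.*2).
    by rewrite maker_part_play oddi setU0.
  have EB : breaker_part (h i.*2.+1) = breaker_part (h i.*2) :|: sB (h i.*2).
    by rewrite breaker_part_play oddi.
  have -> : maker_part (h i.*2.+2) = maker_part (h i.*2.+1) :|: sM (h i.*2.+1).
    by rewrite maker_part_play -[odd _]/(~~ odd i.*2) oddi.
  have -> : breaker_part (h i.*2.+2) = breaker_part (h i.*2.+1).
    by rewrite breaker_part_play -[odd _]/(~~ odd i.*2) oddi setU0.
  have [sS cS] := sMl (h i.*2.+1).
  rewrite EM EB; have [_ /(_ IHi)] := sBP (h i.*2); apply.
    by rewrite -EM -EB -claimedE.
  by rewrite cS geq_minl.
(* At odd [k] Breaker has just moved, so Maker's part is that of the preceding even position. *)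
case=> k [_]; rewrite -(odd_double_half k) -/(h _).
case: odd => /=; last exact: Pfinal (inv _).
rewrite add1n maker_part_play odd_double setU0.
exact: Pfinal (inv _).
Qed.

End Strategies.

(** * Maker's strategy *)

Section Graphs.
Variable n : nat.
Implicit Types (M B S : {set {set 'I_n}}) (J K T : {set 'I_n}).

Definition touching B J : {set {set 'I_n}} := [set e in B | ~~ [disjoint e & J]].

Definition inside B J : {set {set 'I_n}} := [set e in B | e \subset J].

Definition degree B (v : 'I_n) : nat := #|touching B [set v]|.

Lemma in_touching1 B (v : 'I_n) (e : {set 'I_n}) :
  (e \in touching B [set v]) = (e \in B) && (v \in e).
Proof. by rewrite inE disjoint_sym disjoints1 negbK. Qed.

Lemma set2_inj (x y x' y' : 'I_n) K : x \in K -> y \notin K -> x' \in K ->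
  y' \notin K -> [set x; y] = [set x'; y'] -> (x, y) = (x', y').
Proof.
move=> xK yK xK' yK' E.
have /set2P[-> | Ex] : x \in [set x'; y'] by rewrite -E set21.
  have /set2P[Ey | -> //] : y \in [set x'; y'] by rewrite -E set22.
  by rewrite Ey xK' in yK.
by rewrite Ex (negbTE yK') in xK.
Qed.

(** Double counting: an edge contributes [#|e :&: J|], which is 2 inside [J] and 1 if only one
    endpoint lies in [J]. *)
Lemma sum_degree B J : B \subset complete_graph n ->
  \sum_(v in J) degree B v = #|touching B J| + #|inside B J|.
Proof.
move=> sB; under eq_bigr => v _ do
  rewrite /degree -sum1_card (eq_bigl _ _ (in_touching1 B v)) big_mkcondr.
rewrite exchange_big /= -!sum1_card.
rewrite (eq_bigl (fun e => (e \in B) && ~~ [disjoint e & J])); last first.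
  by move=> e; rewrite inE.
rewrite [X in _ + X](eq_bigl (fun e => (e \in B) && (e \subset J))); last first.
  by move=> e; rewrite inE.
rewrite [X in _ = X + _]big_mkcondr [X in _ = _ + X]big_mkcondr -big_split /=.
apply: eq_bigr => e eB; rewrite -big_mkcondr /= sum1_card.
have Ee : #|e| = 2 by move/subsetP/(_ e eB): sB; rewrite inE => /eqP.
transitivity #|e :&: J|; first by apply: eq_card => v; rewrite !inE andbC.
rewrite -setI_eq0 -cards_eq0.
have [/setIidPl -> | nsub] := boolP (e \subset J); first by rewrite Ee.
rewrite addn0.
have : #|e :&: J| < 2.
  rewrite -Ee proper_card // properEneq subsetIl andbT.
  by apply: contra nsub => /eqP/setIidPl.
by case: #|_| => [|[|]].
Qed.

Lemma card_edges_meeting B J T : B \subset complete_graph n -> T \subset J ->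
  #|[set e in inside B J | ~~ [disjoint e & T]]| <= #|T| * #|J|.
Proof.
move=> sB sTJ; rewrite -cardsX.
apply: leq_trans (leq_imset_card (fun p : 'I_n * 'I_n => [set p.1; p.2]) _) => /=.
apply/subset_leq_card/subsetP => e; rewrite 2!inE.
case/andP=> /andP[eB /subsetP eJ].
move=> /pred0Pn[x /= /andP[xe xT]].
have /cards2P[u [v [_ Ee]]] : #|e| == 2 by move/subsetP/(_ e eB): sB; rewrite inE.
apply/imsetP; rewrite {e}Ee in eB eJ xe *.
case/set2P: xe => Ex; rewrite Ex in xT.
  by exists (u, v) => //; rewrite inE /= xT eJ ?set22.
by exists (v, u); rewrite ?inE /= ?xT ?eJ ?set21 // setUC.
Qed.

(** If Breaker owned all edges leaving [K], the stars of [v] and [w] would show that both sides have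
    at most [d], hence at least [n - d] vertices. The larger side has at least n / 2, so [B] would
    have at least n (n - d) / 2 edges. *)
Lemma crossing_edge B K (v w : 'I_n) (d : nat) : v \in K -> w \notin K ->
  degree B v <= d -> degree B w <= d -> 2 * #|B| < n * (n - d) ->
  exists x y, [/\ x \in K, y \notin K & [set x; y] \notin B].
Proof.
move=> vK wK dv dw small.
have [/existsP[x /existsP[y /and3P[xK yK e]]] | no] :=
  boolP [exists x, exists y, [&& x \in K, y \notin K & [set x; y] \notin B]].
  by exists x, y.
exfalso.
have full x y : x \in K -> y \notin K -> [set x; y] \in B.
  move=> xK yK; apply: contraNT no => e.
  by apply/existsP; exists x; apply/existsP; exists y; rewrite xK yK.
have cK : #|K| + #|~: K| = n by rewrite cardsC card_ord.
have le1 : #|~: K| <= d.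
  apply: leq_trans dv; rewrite -(card_in_imset (f := fun y => [set v; y])).
    apply/subset_leq_card/subsetP => e /imsetP[y]; rewrite inE => yK ->.
    by rewrite in_touching1 full // set21.
  move=> y y'; rewrite !inE => yK yK' E.
  by case: (set2_inj vK yK vK yK' E).
have le2 : #|K| <= d.
  apply: leq_trans dw; rewrite -(card_in_imset (f := fun x => [set x; w])).
    apply/subset_leq_card/subsetP => e /imsetP[x xK ->].
    by rewrite in_touching1 full // set22.
  by move=> x x' xK xK' E; case: (set2_inj xK wK xK' wK E).
have le3 : #|K| * #|~: K| <= #|B|.
  rewrite -cardsX -(card_in_imset (f := fun p : 'I_n * 'I_n => [set p.1; p.2])).
    apply/subset_leq_card/subsetP => e /imsetP[[x y]].
    by rewrite !inE /= => /andP[xK yK] ->; apply: full.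
  move=> [x y] [x' y']; rewrite !inE /= => /andP[xK yK] /andP[xK' yK'].
  exact: (set2_inj xK yK xK' yK').
nia.
Qed.

(** * Components of Maker's graph and their active vertices *)

Definition adj M : rel 'I_n := [rel u v | [set u; v] \in M].

(* [f] sends every vertex to the active vertex of its component.  Its classes may
   also be finer than the components, since Maker's surplus edges are ignored. *)
Definition labels (f : 'I_n -> 'I_n) M : Prop :=
  (forall x, f (f x) = f x) /\ (forall x, connect (adj M) x (f x)).

Definition active (f : 'I_n -> 'I_n) : {set 'I_n} := [set x | f x == x].

Lemma connect_adjC M : connect_sym (adj M).
Proof. by apply: sym_connect_sym => x y; rewrite /adj /= setUC. Qed.

Lemma connect_adjS M M' : M \subset M' ->
  subrel (connect (adj M)) (connect (adj M')).
Proof.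
by move=> /subsetP s; apply: connect_sub => x y /s e; apply: connect1.
Qed.

Lemma labelsS f M M' : M \subset M' -> labels f M -> labels f M'.
Proof. by move=> s [ff cf]; split=> // x; apply: connect_adjS s _ _ (cf x). Qed.

Lemma connected_spanningS M M' :
  M \subset M' -> connected_spanning M -> connected_spanning M'.
Proof. by move=> s c x y; apply: (connect_adjS s) (c x y). Qed.

Lemma labels_connected f M :
  labels f M -> #|active f| <= 1 -> connected_spanning M.
Proof.
move=> [ff cf] /card_le1_eqP c1 x y; have Ef : f x = f y.
  by apply: c1; rewrite inE ff.
apply: connect_trans (cf x) _; rewrite Ef -/(adj M) connect_adjC.
exact: cf.
Qed.

Lemma labels_merge f M (v x y : 'I_n) : labels f M -> [set x; y] \in M ->
  f x = v -> f y != v ->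
  exists2 f', labels f' M & active f' = active f :\ v.
Proof.
move=> [ff cf] eM fx fy; pose f' z := if f z == v then f y else f z.
exists f'.
  split=> z; rewrite /f'; case: (eqVneq (f z) v) => [Ez|nz].
  - by rewrite ff (negbTE fy).
  - by rewrite ff (negbTE nz).
  - apply: connect_trans (cf z) _; rewrite Ez -fx.
    apply: connect_trans (cf y); apply: (@connect_trans _ _ x).
      by rewrite connect_adjC.
    exact: connect1.
  - exact: cf.
apply/setP => z; rewrite !inE /f'; case: (eqVneq (f z) v) => [Ez|nz].
  have [<-|zv] := eqVneq (f y) z.
    by rewrite fy ff eqxx.
  by have [->|] := eqVneq z v => //=; rewrite Ez eq_sym => /negbTE->.
by have [Ez|] := eqVneq z v => //=; apply: contraNF nz => /eqP->; rewrite Ez.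
Qed.

(** Greedy merging against a fixed [B]. The vertex deactivated at each merge has the largest degree
    among the active ones, so every vertex lost in the turn dominates all that remain. *)
Lemma maker_turn M B f (d k : nat) : labels f M ->
  (forall v, v \in active f -> degree B v <= d) -> 2 * #|B| < n * (n - d) ->
  exists (S : {set {set 'I_n}}) f', [/\ S \subset complete_graph n :\: (M :|: B), #|S| <= k,
    labels f' (M :|: S), active f' \subset active f &
    #|active f'| <= 1 \/ (#|active f'| + k = #|active f| /\
      {in active f :\: active f' & active f', forall t x, degree B x <= degree B t})].
Proof.
move=> lf dB small; elim: k => [|k [S [f' [sS cS lf' sA alt]]]].
  exists set0, f; rewrite sub0set cards0 setU0 addn0 setDv; split=> //.
  by right; split=> // x y; rewrite inE.
have [le1|gt1] := leqP #|active f'| 1.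
  by exists S, f'; split=> //; [apply: leq_trans cS _|left].
case: alt => [|[cA tA]]; first by rewrite leqNgt gt1.
have /card_gt0P[v0 v0A] : 0 < #|active f'| by apply: leq_trans gt1.
have [v vA vmax] : exists2 v, v \in active f' &
    forall x, x \in active f' -> degree B x <= degree B v.
  by case: (arg_maxnP (degree B) v0A) => v; exists v.
(* A second active vertex lies outside the class of [v], and its degree limits the size of that
   class. *)
have /card_gt0P[w] : 0 < #|active f' :\ v|.
  by move: gt1; rewrite (cardsD1 v) vA.
rewrite !inE => /andP[wv /eqP fw].
have fv : f' v = v by move: (vA); rewrite inE => /eqP.
have wA : w \in active f' by rewrite inE fw.
have := @crossing_edge B [set x | f' x == v] v w d.
rewrite !inE fv fw eqxx wv => /(_ isT isT) [||//|x [y []]].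
- exact/dB/(subsetP sA).
- exact/dB/(subsetP sA).
rewrite !inE => /eqP fx fy eB.
have xy : x != y by apply: contraNneq fy => <-; rewrite fx.
(* Classes may be finer than components, so the crossing edge may already be Maker's; the merge is
   then free. *)
pose S' := if [set x; y] \in M then S else [set x; y] |: S.
have sS' : S \subset S' by rewrite /S'; case: ifP => // _; apply: subsetU1.
have eS' : [set x; y] \in M :|: S'.
  by rewrite inE /S'; case: ifP => //= _; rewrite setU11.
have [f2 lf2 A2] := labels_merge (labelsS (setUS M sS') lf') eS' fx fy.
exists S', f2; split=> //.
- rewrite /S'; case: ifP => // eM; rewrite subUset sub1set sS andbT.
  by rewrite !inE eM (negbTE eB) cards2 xy.
- rewrite /S'; case: ifP => _; first exact: leq_trans cS _.
  by rewrite cardsU1 -add1n leq_add // leq_b1.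
- by rewrite A2; apply: subset_trans sA; apply: subsetDl.
right; rewrite A2; split.
  by rewrite -cA [in RHS](cardsD1 v) vA addnS add1n addSn.
move=> t z; rewrite 3!inE negb_and negbK => /andP[/orP[/eqP->|tA'] tAf] /setD1P[_ zA].
  exact: vmax.
by apply: tA; rewrite // inE tA'.
Qed.

(** * Averaging of Breaker's degrees over sets of active vertices *)

Lemma touchingU B S J : touching (B :|: S) J = touching B J :|: touching S J.
Proof. by apply/setP => e; rewrite !inE andb_orl. Qed.

Lemma card_touchingU B S J : #|touching (B :|: S) J| <= #|touching B J| + #|S|.
Proof.
rewrite touchingU; apply: leq_trans (leq_card_setU _ _) _.
by rewrite leq_add2l subset_leq_card // /touching setIdE subsetIl.
Qed.

(* Averaging over [J :|: T] loses only the edges inside it that meet [T]. *)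
Lemma touching_average B J T : B \subset complete_graph n -> [disjoint J & T] ->
  {in T & J, forall t x, degree B x <= degree B t} ->
  (#|J| + #|T|) * #|touching B J| <=
  #|J| * (#|touching B (J :|: T)| + #|T| * (#|J| + #|T|)).
Proof.
move=> sB dJT leJT.
have cJT : #|J :|: T| = #|J| + #|T|.
  by rewrite cardsU disjoint_setI0 // cards0 subn0.
have sumJT : \sum_(v in J :|: T) degree B v =
    \sum_(v in J) degree B v + \sum_(v in T) degree B v.
  by rewrite -bigU //; apply: eq_bigl => v; rewrite inE.
have avg : #|T| * \sum_(v in J) degree B v <= #|J| * \sum_(v in T) degree B v.
  rewrite -sum_nat_const [X in _ <= X]big_distrr /=; apply: leq_sum => t tT.
  by rewrite -sum_nat_const; apply: leq_sum => x xJ; apply: leJT.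
have le_inside : #|inside B (J :|: T)| <= #|inside B J| + #|T| * (#|J| + #|T|).
  rewrite -cJT; apply: leq_trans (leq_add (leqnn _) (card_edges_meeting sB (subsetUr J T))).
  apply: leq_trans (leq_card_setU _ _); apply/subset_leq_card/subsetP => e.
  rewrite !inE => /andP[-> eJT] /=; rewrite eJT /=.
  have [dT|] := boolP [disjoint e & T]; last by rewrite orbT.
  rewrite orbF; apply/subsetP => x xe; have := subsetP eJT x xe.
  by rewrite inE (disjointFr dT xe) orbF.
move: avg sumJT; rewrite !sum_degree //.
nia.
Qed.

Section Potential.
Local Open Scope ring_scope.

(* In the recursion for [phi], the first alternative says that the total number of
   Breaker's edges already gives the bound for sets of [r] active vertices. *)
Lemma maker_wins_of_potential (R : realFieldType) (a a' b : nat) (phi : nat -> R) :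
  (0 < a' <= a)%N -> (0 < b)%N ->
  (forall r, (0 < r <= n)%N -> 0 <= phi r) ->
  (forall r, (0 < r <= n)%N -> b%:R * n%:R <= a'%:R * (r%:R * phi r) \/
     phi (r + a')%N + b%:R / (r + a')%:R + a'%:R <= phi r) ->
  n%:R * (phi 1%N + b%:R) + 2 * (b%:R * n%:R / a'%:R + b%:R) < n%:R * n%:R ->
  maker_wins_connectivity n a b.
Proof.
move=> /andP[a'_gt0 lea'a] b_gt0 phi_ge0 phi_rec phi_small.
have leJn J : (#|J| <= n)%N by rewrite -[X in (_ <= X)%N]card_ord max_card.
pose bounded f B := forall J, J \subset active f -> (0 < #|J|)%N ->
  #|touching B J|%:R <= #|J|%:R * phi #|J|.
(* The weighted count charges [b] edges of Breaker to every [a'] active vertices lost, which keeps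
   [#|B|] below b n / a'. *)
pose inv M B := B \subset complete_graph n /\ (connected_spanning M \/
  exists f, [/\ labels f M, (a' * #|B| + b * #|active f| <= b * n)%N & bounded f B]).
(* By [bounded] for singletons, degrees at active vertices in [B :|: S] are at most [phi 1 + b].
   With the bound on [#|B|], [phi_small] then gives what [crossing_edge] asks for. *)
have turn M B f (S : {set {set 'I_n}}) : labels f M ->
    (a' * #|B| + b * #|active f| <= b * n)%N -> bounded f B -> (#|S| <= b)%N ->
  forall k : nat, exists (S' : {set {set 'I_n}}) f',
    [/\ S' \subset complete_graph n :\: (M :|: (B :|: S)), (#|S'| <= k)%N,
        labels f' (M :|: S'), active f' \subset active f &
    (#|active f'| <= 1)%N \/ ((#|active f'| + k)%N = #|active f| /\
      {in active f :\: active f' & active f',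
        forall t x, (degree (B :|: S) x <= degree (B :|: S) t)%N})].
  move=> lf cB gB cS k.
  have n_gt0 : (0 < n)%N.
    case: (posnP n) => // n0; move: phi_small.
    by rewrite n0 !mulr0 !mul0r add0r add0r ltNge mulr_ge0 ?ler0n.
  have /card_gt0P[v0 v0A] : (0 < #|active f|)%N.
    have v : 'I_n by exact: Ordinal n_gt0.
    by apply/card_gt0P; exists (f v); rewrite inE (proj1 lf).
  have [v vA vmax] : exists2 v, v \in active f &
      forall x, x \in active f -> (degree (B :|: S) x <= degree (B :|: S) v)%N.
    by case: (arg_maxnP (degree (B :|: S)) v0A) => v; exists v.
  apply: maker_turn lf vmax _.
  have cBS : (#|B :|: S| <= #|B| + #|S|)%N by apply: leq_card_setU.
  have dv : (degree (B :|: S) v)%:R <= phi 1%N + b%:R.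
    have := gB [set v]; rewrite sub1set vA cards1 mul1r => /(_ isT isT) le1.
    apply: (@le_trans _ _ (#|touching B [set v]| + #|S|)%:R).
      by rewrite ler_nat card_touchingU.
    by rewrite natrD lerD // ler_nat.
  rewrite -(ltr_nat R) !natrM.
  have : (#|B :|: S|)%:R <= b%:R * n%:R / a'%:R + b%:R :> R.
    apply: (@le_trans _ _ (#|B| + #|S|)%:R); first by rewrite ler_nat.
    rewrite natrD lerD ?ler_nat //.
    rewrite ler_pdivlMr ?ltr0n // -!natrM ler_nat mulnC.
    by apply: leq_trans cB; apply: leq_addr.
  have : (n%:R - (degree (B :|: S) v)%:R : R) <= (n - degree (B :|: S) v)%:R.
    have [le|lt] := leqP (degree (B :|: S) v) n; first by rewrite natrB.
    by rewrite (le_trans _ (ler0n _ _)) // subr_le0 ler_nat ltnW.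
  have : 0 < n%:R :> R by rewrite ltr0n.
  move: phi_small dv; set d := _%:R; set nd := (n - _)%:R; set c := #|_|%:R.
  by move=> *; nra.
apply: (@maker_wins_by_invariant _ _ _ _ _ inv) => //.
- split; first exact: sub0set.
  right; exists id; split=> [||J _ J_gt0]; first by split=> // x; apply: connect0.
    by rewrite cards0 muln0 add0n leq_mul2l leJn orbT.
  rewrite (_ : touching _ _ = set0) ?cards0 ?mulr_ge0 ?phi_ge0 ?J_gt0 ?leJn //.
  by apply/setP => e; rewrite !inE.
- move=> M M' B sMM' [sB [cM|[f [lf cB gB]]]]; split=> //.
    by left; apply: connected_spanningS cM.
  by right; exists f; split=> //; apply: labelsS lf.
- move=> M B S [sB alt] sS cS.
  have sBS : B :|: S \subset complete_graph n.
    by rewrite subUset sB; apply: subset_trans sS _; apply: subsetDl.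
  case: alt => [cM|[f [lf cB gB]]].
    by exists set0; rewrite sub0set cards0 setU0; split=> //; split=> //; left.
  have [S' [f' [sS' cS' lf' sA alt]]] := turn _ _ _ _ lf cB gB cS a'.
  exists S'; split=> //; first exact: leq_trans cS' _.
  split=> //; case: alt => [le1|[cA tA]]; first by left; apply: labels_connected lf' le1.
  right; exists f'; have cBS : (#|B :|: S| <= #|B| + #|S|)%N by apply: leq_card_setU.
  have cB' : (a' * #|B :|: S| + b * #|active f'| <= b * n)%N by nia.
  split=> // J sJ J_gt0; pose T := active f :\: active f'.
  have cT : #|T| = a' by rewrite cardsD (setIidPr sA) -cA addKn.
  (* Either the total edge count suffices, or [J] is averaged with the set [T] of the [a'] vertices
     just lost, and the bound from before the turn applies to [J :|: T]. *)
  have [|big|rec] := phi_rec #|J|; first by rewrite J_gt0 leJn.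
    have : #|touching (B :|: S) J|%:R <= #|B :|: S|%:R :> R.
      by rewrite ler_nat subset_leq_card // /touching setIdE subsetIl.
    move/le_trans; apply; rewrite -(ler_pM2l (x := a'%:R)) ?ltr0n //.
    apply: le_trans big; rewrite -!natrM ler_nat.
    by apply: leq_trans cB'; apply: leq_addr.
  have dJT : [disjoint J & T].
    rewrite (disjointWl sJ) // disjoint_sym.
    by have := subxx T; rewrite {2}/T subsetD => /andP[].
  have := @touching_average (B :|: S) J T sBS.
  move=> /(_ dJT (fun t x tT xJ => tA t x tT (subsetP sJ x xJ))); rewrite cT => le2.
  have cJT : #|J :|: T| = (#|J| + a')%N.
    by rewrite cardsU disjoint_setI0 // cards0 subn0 cT.
  have := gB (J :|: T); rewrite subUset (subset_trans sJ sA) subsetDl cJT.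
  rewrite addn_gt0 J_gt0 => /(_ isT isT) gJT.
  have := card_touchingU B S (J :|: T).
  move: le2 => /[swap]; move: rec gJT; move: (phi _) (phi _) => p q.
  rewrite -!(ler_nat R) !(natrD, natrM).
  have : (0 < #|J|%:R :> R) by rewrite ltr0n.
  have : (0 < a'%:R :> R) by rewrite ltr0n.
  move: (#|J|%:R) (a'%:R) => r s s0 r0 rec gJT le1 le2.
  have cSb : #|S|%:R <= b%:R :> R by rewrite ler_nat.
  have rs0 : 0 < r + s by rewrite addr_gt0.
  rewrite -(ler_pM2l rs0); apply: le_trans le2 _.
  rewrite mulrCA ler_pM2l //.
  have -> : (r + s) * p =
      (r + s) * (p - q - s - b%:R / (r + s)) + (r + s) * q + b%:R + s * (r + s).
    by field; lra.
  have : 0 <= (r + s) * (p - q - s - b%:R / (r + s)).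
    by rewrite mulr_ge0 ?(ltW rs0) //; lra.
  lra.
move=> M B [sB [cM|[f [lf cB gB]]]] sX; first by exists M.
(* On the full board [n] merges are requested. They can claim no edge, and either alternative leaves
   at most one active vertex, so [M] itself is connected. *)
have [|S' [f' [sS' cS' lf' sA alt]]] := turn _ _ _ set0 lf cB gB _ n.
  by rewrite cards0.
have S'0 : S' = set0.
  apply/eqP; rewrite -subset0; apply: subset_trans sS' _; rewrite setU0.
  by rewrite subset0 setD_eq0.
rewrite S'0 setU0 in lf'; exists M => //; apply: labels_connected lf' _.
by case: alt => // [[cA _]]; have := leJn (active f); rewrite -cA; lia.
Qed.

End Potential.

(** * Breaker's strategy *)

Definition clique B J : Prop := {in J &, forall x y, x != y -> [set x; y] \in B}.

Definition untouched M J : Prop := {in M, forall e : {set 'I_n}, [disjoint e & J]}.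

(** Only Breaker's edges are removed: at a vertex untouched by Maker these are exactly the unclaimed
    edges. *)
Definition free B (v : 'I_n) : {set {set 'I_n}} :=
  [set e in complete_graph n :\: B | v \in e].

Lemma cliqueS B B' J J' : B \subset B' -> J' \subset J -> clique B J -> clique B' J'.
Proof.
move=> sB sJ c x y xJ yJ xy; apply: (subsetP sB).
by apply: c xy; apply: (subsetP sJ).
Qed.

Lemma untouchedS M J J' : J' \subset J -> untouched M J -> untouched M J'.
Proof. by move=> sJ uJ e /uJ; apply: disjointWr. Qed.

Lemma untouchedU M M' J : untouched M J -> untouched M' J -> untouched (M :|: M') J.
Proof. by move=> u u' e; rewrite inE => /orP[/u|/u']. Qed.

Lemma freeS B B' v : B \subset B' -> #|free B' v| <= #|free B v|.
Proof.
move=> sB; apply/subset_leq_card/subsetP => e; rewrite !inE.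
by case/andP=> /andP[eB' ->] ->; rewrite !andbT; apply: contra eB'; apply: (subsetP sB).
Qed.

Lemma leq_card_free B v : #|free B v| <= n.-1.
Proof.
have <- : #|[set~ v]| = n.-1 by rewrite cardsC1 card_ord.
apply: leq_trans (leq_imset_card (fun u => [set v; u]) _).
apply/subset_leq_card/subsetP => e.
rewrite 3!inE => /andP[/andP[_ /cards2P[x [y [xy ->]]]] /set2P[->|->]].
  by apply: imset_f; rewrite !inE eq_sym.
by rewrite setUC; apply: imset_f; rewrite !inE.
Qed.

Lemma card_cover_edges M : M \subset complete_graph n -> #|cover M| <= 2 * #|M|.
Proof.
move=> /subsetP sM; apply: leq_trans (leq_card_cover _) _.
rewrite mulnC -sum_nat_const; apply: leq_sum => e /sM.
by rewrite inE => /eqP->.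
Qed.

Lemma untouched_coverC M J : [disjoint cover M & J] -> untouched M J.
Proof. by move=> d e eM; apply: disjointWl d; apply: bigcup_sup. Qed.

Lemma not_connected_untouched M (v : 'I_n) : 1 < n -> untouched M [set v] ->
  ~ contains_connected_spanning M.
Proof.
move=> n_gt1 uv [S /subsetP sSM cS].
have /card_gt0P[u] : 0 < #|[set~ v]| by rewrite cardsC1 card_ord -subn1 subn_gt0.
rewrite !inE => uv'; have /connectP[[|w p] /=] := cS v u.
  by move=> _ E; rewrite E eqxx in uv'.
case/andP=> /sSM /uv; rewrite disjoint_sym disjoints1.
by rewrite !inE eqxx.
Qed.

(* Maker's edges leave the clique, so each of them meets it at most once. *)
Lemma survivors B M J (a : nat) : clique B J ->
  M \subset complete_graph n -> [disjoint M & B] -> #|M| <= a ->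
  exists2 J' : {set 'I_n}, J' \subset J & #|J'| = #|J| - a /\ untouched M J'.
Proof.
move=> cJ /subsetP sM dMB cM.
have le1 : #|J :&: cover M| <= a.
  apply: leq_trans cM; rewrite /cover big_distrr /=.
  apply: leq_trans (leq_card_bigcup _ _) _.
  rewrite -sum1_card; apply: leq_sum => e eM; rewrite leqNgt.
  apply/negP => /card_gt1P[x [y []]]; rewrite !inE => /andP[xJ xe] /andP[yJ ye] xy.
  have Ee : e = [set x; y].
    apply/eqP; rewrite eq_sym eqEcard subUset !sub1set xe ye cards2 xy /=.
    by move: (sM _ eM); rewrite inE => /eqP->.
  by move: (disjointFr dMB eM); rewrite Ee cJ.
have [||J' [_ sJ' cJ']] := @legal_extension _ (J :\: cover M) set0 (#|J| - a).
- exact: sub0set.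
- by rewrite cards0.
exists J'; first by apply: subset_trans sJ' _; apply: subsetDl.
split; first by rewrite cJ' (minn_idPl _) // cardsD leq_sub2l.
apply: untouched_coverC; rewrite disjoint_sym.
by move: sJ'; rewrite subsetD => /andP[].
Qed.

(** Maker's edges cover at most [2 * #|M|] vertices, so [q] fresh ones exist outside [J]. Breaker
    claims their edges to the enlarged clique that he lacks. *)
Lemma clique_extension M B J (q : nat) : M \subset complete_graph n ->
  untouched M J -> clique B J -> 2 * #|M| + #|J| + q <= n ->
  exists J' (S : {set {set 'I_n}}), [/\ #|J'| = #|J| + q, untouched M J', clique (B :|: S) J',
    S \subset complete_graph n :\: (M :|: B) & #|S| <= q * (#|J| + q)].
Proof.
move=> sM uJ cJ room.
have [||N [_ sN cN]] := @legal_extension _ (~: (J :|: cover M)) set0 q.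
- exact: sub0set.
- by rewrite cards0.
have {}cN : #|N| = q.
  rewrite cN (minn_idPl _) // cardsCs setCK card_ord.
  have [leU _] := leq_card_setU J (cover M); have := card_cover_edges sM.
  lia.
move: sN; rewrite -disjoints_subset => dN.
have dNJ : [disjoint J & N].
  by rewrite disjoint_sym; apply: disjointWr dN; apply: subsetUl.
have uN : untouched M N.
  apply: untouched_coverC; rewrite disjoint_sym.
  by apply: disjointWr dN; apply: subsetUr.
have cJN : #|J :|: N| = #|J| + q by rewrite cardsU disjoint_setI0 // cards0 subn0 cN.
have uJN : untouched M (J :|: N).
  by move=> e eM; rewrite -setI_eq0 setIUr setU_eq0 !setI_eq0 uJ ?uN.
pose S := [set [set x; y] | x in N, y in J :|: N] :&: complete_graph n :\: B.
exists (J :|: N), S; split=> //.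
- move=> x y xJN yJN xy.
  have inS u v : u \in N -> v \in J :|: N -> u != v -> [set u; v] \in B :|: S.
    move=> uN' vJN uv; rewrite in_setU /S in_setD; case: (boolP (_ \in B)) => //= _.
    rewrite in_setI inE cards2 uv andbT.
    by apply/imset2P; exists u v.
  case/setUP: (xJN) => [xJ|xN]; last exact: inS.
  case/setUP: (yJN) => [yJ|yN]; first by rewrite inE cJ.
  by rewrite setUC inS // eq_sym.
- apply/subsetP => e /setDP[/setIP[/imset2P[x y xN yJN ->] eX] eB].
  rewrite inE eX andbT inE negb_or eB andbT.
  by apply: contraL xN => /uN /disjointFr/(_ (set21 x y))->.
- rewrite -cJN -cN -cardsX.
  apply: leq_trans (leq_imset_card (fun p : 'I_n * 'I_n => [set p.1; p.2]) _).
  apply/subset_leq_card/subsetP => e /setDP[/setIP[/imset2P[x y xN yJN ->] _] _].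
  by apply/imsetP; exists (x, y) => //; rewrite in_setX xN.
Qed.

(** A box game played on stars. While building, a round adds [a + 1] vertices and Maker spoils at
    most [a], so one is gained. At level [j] there remain [1 + a * j] stars with at most [L j] free
    edges each, and the last hypothesis says that [L 0 <= b]. For [q = 0] a vertex is isolated at
    once. *)
Lemma breaker_wins_of_boxes (a b q : nat) : 1 < n -> 0 < a ->
  (0 < q -> a.+1 * (a * q + a.+1) <= b /\ 2 * (a * (a * q)) + a * q + a.+1 <= n) ->
  n <= (b + \sum_(1 <= m < q.+1) b %/ (1 + a * m)).+1 ->
  breaker_wins_connectivity n a b.
Proof.
move=> n_gt1 a_gt0 room final.
pose L j := n.-1 - \sum_(j.+1 <= m < q.+1) b %/ (1 + a * m).
pose building M B i J := [/\ #|J| = i.+1, i < a * q, clique B J, untouched M J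
                           & #|M| <= a * i].
pose boxes M B j J := [/\ #|J| = 1 + a * j, j <= q, clique B J, untouched M J
                           & {in J, forall v, #|free B v| <= L j}].
pose inv M B := M \subset complete_graph n /\
  exists i J, building M B i J \/ boxes M B i J.
have Lq : L q = n.-1 by rewrite /L big_geq // subn0.
have start M B J : #|J| = 1 + a * q -> clique B J -> untouched M J -> boxes M B q J.
  by move=> cJ qJ uJ; split=> // v _; rewrite Lq leq_card_free.
apply: (@breaker_wins_by_invariant _ _ _ _ _ inv).
- split; first exact: sub0set.
  pose v := Ordinal (ltnW n_gt1).
  have cv : clique set0 [set v].
    by move=> x y /set1P-> /set1P->; rewrite eqxx.
  have uv : untouched set0 [set v] by move=> e; rewrite inE.
  exists 0, [set v]; have [aq0|aq_gt0] := posnP (a * q); last first.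
    by left; split; rewrite ?cards1 ?cards0.
  have q0 : q = 0.
    by move/eqP: aq0; rewrite muln_eq0 (gtn_eqF a_gt0) => /eqP.
  by right; have := start set0 set0 [set v]; rewrite q0 muln0 cards1; apply.
- move=> M B B' sB [sM [i [J alt]]]; split=> //; exists i, J.
  case: alt => [[]|[]] cJ ltiq qJ uJ h; [left | right]; split=> //.
  + exact: cliqueS qJ.
  + exact: cliqueS qJ.
  + by move=> v vJ; apply: leq_trans (freeS _ sB) _; apply: h.
- move=> M B [sM [i [J [[cJ ltiq qJ uJ cM]|[cJ leiq qJ uJ fJ]]]]].
    have q_gt0 : 0 < q by case: (posnP q) ltiq => // ->; rewrite muln0.
    have [le1 le2] := room q_gt0.
    have [|J' [S [cJ' uJ' qJ' sS cS]]] := clique_extension sM uJ qJ (q := a.+1).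
      rewrite cJ; nia.
    exists S; split=> //.
      apply: leq_trans le1; apply: leq_trans cS _.
      by rewrite cJ leq_mul2l leq_add2r ltiq orbT.
    move=> S' sS' cS'.
    move: sS'; rewrite subsetD setUCA => /andP[sS' dS'].
    have [|J2 sJ2 [cJ2 uJ2]] := survivors qJ' sS' _ cS'.
      by apply: disjointWr dS'; rewrite -setUCA; apply: subsetUr.
    have {}cJ2 : #|J2| = i.+2 by rewrite cJ2 cJ' cJ; lia.
    split; first by rewrite subUset sM.
    have q2 : clique (B :|: S) J2 by apply: cliqueS qJ'.
    have u2 : untouched (M :|: S') J2.
      by apply: untouchedU => //; apply: untouchedS uJ'.
    have [ltiq'|] := ltnP i.+1 (a * q).
      exists i.+1, J2; left; split=> //.
      by apply: leq_trans (leq_card_setU _ _) _; rewrite mulnS addnC leq_add.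
    move=> leqi; have Ei : i.+1 = a * q by apply/eqP; rewrite eqn_leq ltiq.
    by exists q, J2; right; apply: start; rewrite // cJ2 Ei.
  pose m := b %/ (1 + a * i).
  have /choice[F FP] : forall v, exists S : {set {set 'I_n}},
      [/\ S \subset free B v & #|S| = minn m #|free B v|].
    move=> v; have [||S [_ sS cS]] := @legal_extension _ (free B v) set0 m.
    - exact: sub0set.
    - by rewrite cards0.
    by exists S.
  pose S := \bigcup_(v in J) F v.
  have sS : S \subset complete_graph n :\: (M :|: B).
    apply/bigcupsP => v vJ; apply/subsetP => e eF.
    have [sF _] := FP v; move/(subsetP sF): eF.
    rewrite !inE => /andP[/andP[eB ->] ve]; rewrite negb_or eB !andbT.
    by apply: contraL vJ => /uJ /disjointFr/(_ ve)->.
  have fS v : v \in J -> #|free (B :|: S) v| <= #|free B v| - m.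
    move=> vJ; have [sF cF] := FP v.
    apply: (@leq_trans #|free B v :\: F v|).
      apply/subset_leq_card/subsetP => e; rewrite !inE negb_or.
      case/andP=> /andP[/andP[-> eS] ->] ->; rewrite !andbT.
      by apply: contra eS; apply/subsetP/bigcup_sup.
    rewrite cardsD (setIidPr sF) cF; lia.
  have cS : #|S| <= b.
    apply: leq_trans (leq_divM b (1 + a * i)); rewrite -/m -cJ mulnC -sum_nat_const.
    apply: leq_trans (leq_card_bigcup _ _) _; apply: leq_sum => v _.
    by have [_ ->] := FP v; apply: geq_minl.
  exists S; split=> // S' sS' cS'.
  move: sS'; rewrite subsetD => /andP[sS' dS'].
  have dSB : [disjoint S' & B :|: S] by apply: disjointWr dS'; apply: subsetUr.
  have q1 : clique (B :|: S) J by apply: cliqueS qJ => //; apply: subsetUl.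
  split; first by rewrite subUset sM.
  (* At level 0 the whole last star now belongs to Breaker. Maker cannot touch its centre, and the
     same [J] serves forever. *)
  case: i => [|i] in cJ leiq fJ m FP S sS fS cS dS' dSB q1 *.
    exists 0, J; right; split=> //; last first.
      by move=> v vJ; apply: leq_trans (fJ v vJ); apply/freeS/subsetUl.
    apply: untouchedU => // e eS'; rewrite -setI_eq0; apply/eqP/setP => v.
    rewrite !inE; apply/negP => /andP[ve vJ].
    have : #|free (B :|: S) v| <= 0.
      apply: leq_trans (fS v vJ) _; rewrite leqn0 subn_eq0.
      apply: leq_trans (fJ v vJ) _; rewrite /L /m muln0 divn1.
      by rewrite -subn1 !leq_subLR add1n addnC.
    rewrite leqn0 cards_eq0 => /eqP/setP/(_ e).
    by rewrite in_set0 inE ve andbT in_setD (subsetP sS' _ eS') andbT (disjointFr dSB eS').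
  have [J2 sJ2 [cJ2 uJ2]] := survivors q1 sS' dSB cS'.
  exists i, J2; right; split.
  + by rewrite cJ2 cJ mulnS; lia.
  + exact: ltnW.
  + exact: cliqueS q1.
  + by apply: untouchedU => //; apply: untouchedS uJ.
  + move=> v /(subsetP sJ2) vJ; apply: leq_trans (fS v vJ) _.
    rewrite /L big_ltn // [in _ + _]addnC subnDA leq_sub2r //; exact: fJ.
move=> M B [sM [i [J alt]]].
have [v vJ uJ] : exists2 v, v \in J & untouched M J.
  have cJ : 0 < #|J| by case: alt => [[-> _ _ _]|[-> _ _ _]].
  by case/card_gt0P: cJ => v vJ; exists v => //; case: alt => [[]|[]].
by apply: (@not_connected_untouched _ v) => //; apply: untouchedS uJ; rewrite sub1set.
Qed.

End Graphs.

(** * Asymptotics *)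

Unset Implicit Arguments.
Set Strict Implicit.

From mathcomp Require Import all_classical all_reals all_analysis.

Import Order.TTheory GRing.Theory Num.Theory.
Import numFieldNormedType.Exports.
Local Open Scope classical_set_scope.
Local Open Scope ring_scope.

Section Asymptotics.
Variable R : realType.
Implicit Types (x y C eps : R) (n a b q : nat).

(** * Elementary estimates for the exponential and the logarithm *)

Lemma ln_natr_large x : exists n0, forall n, (n0 <= n)%N -> x <= ln (n%:R : R).
Proof.
exists (Num.bound (expR x)) => n le_n.
have lt_n : expR x < n%:R.
  by apply: lt_le_trans (archi_boundP (expR_ge0 x)) _; rewrite ler_nat.
by rewrite -[x]expRK ler_ln ?posrE ?expR_gt0 ?(lt_trans (expR_gt0 x)) ?ltW.
Qed.

Lemma expR_ge_expr x n : 0 <= x -> x ^+ n.+1 / n.+1`!%:R <= expR x.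
Proof. by move=> /(@expR_ge1Dxn _ _ n); apply: le_trans; rewrite lerDr. Qed.

Lemma expR_ln_natr n : 0 < ln (n%:R : R) -> expR (ln n%:R) = n%:R :> R.
Proof.
move=> ln_gt0; apply: lnK; rewrite posrE ltNge; apply/negP => n_le0.
by move: ln_gt0; rewrite ltNge ln_le0 // (le_trans n_le0).
Qed.

(** This is ln (1 + t) <= t at t = - y / (x + y); the next lemma takes t = y / x. *)
Lemma ln_increment x y : 0 < x -> 0 <= y -> y / (x + y) <= ln (x + y) - ln x.
Proof.
move=> x_gt0 y_ge0; have xy_gt0 : 0 < x + y by lra.
rewrite -opprB lerNr -ln_div ?posrE //.
have -> : x / (x + y) = 1 + - (y / (x + y)) by field; lra.
apply: le_ln1Dx; rewrite ltrN2 ltr_pdivrMr //; lra.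
Qed.

Lemma ln_increment_le x y : 0 < x -> 0 <= y -> ln (x + y) - ln x <= y / x.
Proof.
move=> x_gt0 y_ge0; have xy_gt0 : 0 < x + y by lra.
rewrite -ln_div ?posrE //.
have -> : (x + y) / x = 1 + y / x by field; lra.
apply: le_ln1Dx; apply: lt_le_trans (divr_ge0 y_ge0 (ltW x_gt0)); exact: ltrN10.
Qed.

Lemma maker_wins_asymptotic C eps : 0 <= C -> 0 < eps ->
  exists n0, forall n, (n0 <= n)%N -> forall a a' b, (0 < a' <= a)%N -> (0 < b)%N ->
    a'%:R <= C * ln n%:R -> b%:R * (1 + ln n%:R / a'%:R) <= (1 - eps) * n%:R ->
    maker_wins_connectivity n a b.
Proof.
move=> C_ge0 eps_gt0.
(* [K * p] will gather the [4 / eps * p] of [phi 1] and the [2 * p] of the edge count; [X] gathers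
   the lower bounds on ln n used below. *)
pose K := 4 / eps + 2; have K_ge0 : 0 <= K by rewrite addr_ge0 ?divr_ge0 // ltW.
pose X := 1 + 8 * (C + 2) / eps + K * (4 / eps).
have X1 : 0 <= 8 * (C + 2) / eps by rewrite divr_ge0 ?mulr_ge0 ?addr_ge0 // ltW.
have X2 : 0 <= K * (4 / eps) by rewrite mulr_ge0 ?divr_ge0 // ltW.
have [n0 n0P] := ln_natr_large X.
exists n0 => n /n0P; set x := ln _ => leXx a a' b a'P b_gt0 leCa' bias.
have x_gt0 : 0 < x by rewrite (lt_le_trans _ leXx) // /X; lra.
have Nx : expR x = n%:R by apply: expR_ln_natr.
set N : R := n%:R in Nx bias *.
have leN : x ^+ 2 / 2 <= N by rewrite -Nx; have := @expR_ge_expr x 1 (ltW x_gt0).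
have N_gt0 : 0 < N by rewrite -Nx expR_gt0.
have n_gt0 : (0 < n)%N by rewrite -(ltr0n R).
have a'_gt0 : 0 < a'%:R :> R by rewrite ltr0n; case/andP: a'P.
have leKx : K * (4 / eps) <= x by rewrite (le_trans _ leXx) // /X; lra.
have ltCx : 8 * (C + 2) / eps < x by rewrite (lt_le_trans _ leXx) // /X; lra.
have le1x : 1 <= x by rewrite (le_trans _ leXx) // /X; lra.
set p := b%:R / a'%:R : R.
have p_ge0 : 0 <= p by rewrite divr_ge0.
have biasp : b%:R + p * x <= (1 - eps) * N.
  by move: bias; rewrite mulrDr mulr1 /p mulrA mulrAC.
have b_ge0 : 0 <= b%:R :> R by [].
(* From size [r0] on, the edge total [p * N] is good enough. Below [r0], the logarithm pays for
   [b / (r + a')], and the last term, of slope -1 in [r], pays for [a']. *)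
pose r0 := eps * N / 4; have r0_gt0 : 0 < r0 by rewrite divr_gt0 ?mulr_gt0.
pose phi r : R := p * N / r0 + p * (x - ln r%:R) + Num.max 0 (r0 + a'%:R - r%:R).
have lnr r : (0 < r <= n)%N -> 0 <= x - ln r%:R.
  move=> /andP[r_gt0 lern]; rewrite subr_ge0 ler_ln ?posrE ?ltr0n //.
  by rewrite ler_nat.
have phi_ge r : (0 < r <= n)%N -> p * N / r0 <= phi r.
  move=> rP; rewrite /phi -addrA lerDl addr_ge0 ?mulr_ge0 ?lnr //.
  by rewrite le_max lexx.
apply: (@maker_wins_of_potential n R a a' b phi) => //.
- move=> r /phi_ge; apply: le_trans.
  by rewrite divr_ge0 ?mulr_ge0 // ltW.
- move=> r rP; have r_gt0 : 0 < r%:R :> R by rewrite ltr0n; case/andP: rP.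
  have [ler|ltr] := lerP r0 r%:R; [left | right].
    apply: (@le_trans _ _ (a'%:R * (r0 * (p * N / r0)))).
      rewrite (_ : a'%:R * _ = b%:R * N) // /p.
      by field; rewrite !gt_eqF.
    rewrite ler_pM2l //; apply: ler_pM => //; first exact: ltW.
      by rewrite divr_ge0 ?mulr_ge0 // ltW.
    exact: phi_ge.
  rewrite /phi natrD.
  have := ln_increment _ a'%:R r_gt0 (ler0n _ _).
  rewrite !(max_idPr _); try lra.
  move=> /(ler_wpM2l p_ge0).
  have -> : p * (a'%:R / (r%:R + a'%:R)) = b%:R / (r%:R + a'%:R).
    by rewrite /p; field; rewrite !gt_eqF // addr_gt0.
  lra.
have phi1 : phi 1%N <= 4 / eps * p + p * x + (eps * N / 4 + a'%:R).
  rewrite /phi ln1 subr0 -/r0 (_ : p * N / r0 = 4 / eps * p); last first.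
    by rewrite /r0; field; rewrite !gt_eqF.
  by rewrite lerD2l ge_max; apply/andP; split; lra.
have -> : b%:R * N / a'%:R = p * N by rewrite /p mulrAC.
have pK : K * p <= eps / 4 * N.
  have : K * (4 / eps) * p <= N.
    apply: le_trans (ler_wpM2r p_ge0 leKx) _; rewrite mulrC.
    have : 0 <= eps * N by rewrite mulr_ge0 // ltW.
    lra.
  move=> /(ler_wpM2l (ltW eps_gt0)).
  have -> : eps * (K * (4 / eps) * p) = 4 * (K * p) by field; rewrite gt_eqF.
  lra.
have small : C * x + 2 < eps / 4 * N.
  have : C * x + 2 <= (C + 2) * x by rewrite mulrDl lerD2l; lra.
  move/le_lt_trans; apply.
  apply: (@lt_le_trans _ _ (eps / 4 * (x ^+ 2 / 2))); last first.
    by rewrite ler_wpM2l // divr_ge0 // ltW.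
  rewrite ltr_pdivrMr // in ltCx.
  have : 8 * (C + 2) * x < x * eps * x by rewrite ltr_pM2r.
  rewrite expr2; lra.
have bN : b%:R <= N.
  have : 0 <= p * x + eps * N by rewrite addr_ge0 ?mulr_ge0 // ltW.
  lra.
rewrite (_ : n%:R = N) //.
(* Three errors remain, [K * p], [C * x + 2] and [eps * N / 4], each at most a quarter of
   [eps * N]. *)
apply: (@le_lt_trans _ _ (N * (phi 1%N + b%:R + 2 * p + 2))); first lra.
rewrite ltr_pM2l //.
have : K * p = 4 / eps * p + 2 * p by rewrite mulrDl.
lra.
Qed.

Lemma maker_wins_below_threshold eps : 0 < eps -> exists n0, forall n, (n0 <= n)%N ->
  forall a b, (0 < a)%N -> (0 < b)%N ->
    b%:R <= (1 - eps) * (a%:R * n%:R / (a%:R + ln n%:R)) \/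
    (2 / eps + 1) * ln n%:R < a%:R /\ b%:R <= (1 - eps) * n%:R ->
    maker_wins_connectivity n a b.
Proof.
move=> eps_gt0; pose C := 2 / eps + 1.
have C_ge0 : 0 <= C by rewrite addr_ge0 ?divr_ge0 // ltW.
have [n1 n1P] := maker_wins_asymptotic C (eps / 2) C_ge0 (divr_gt0 eps_gt0 (ltr0Sn R 1)).
have [n2 n2P] := ln_natr_large 1.
exists (maxn n1 n2) => n; rewrite geq_max => /andP[/n1P win /n2P].
set x := ln _ in win * => le1x a b a_gt0 b_gt0 alt.
have a_gt0R : 0 < a%:R :> R by rewrite ltr0n.
have x_gt0 : 0 < x by lra.
set N : R := n%:R in win alt *.
have N_ge0 : 0 <= N by [].
have [leaC | ltCa] := lerP a%:R (C * x).
  case: alt => [bias | [lt _]]; last by rewrite ltNge leaC in lt.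
  apply: (win a a); rewrite ?a_gt0 ?leqnn //.
  have -> : b%:R * (1 + x / a%:R) = b%:R * (a%:R + x) / a%:R by field; rewrite gt_eqF.
  rewrite ler_pdivrMr //.
  move: bias; rewrite mulrA ler_pdivlMr; last by lra.
  move/le_trans; apply.
  have : 0 <= eps * N * a%:R by rewrite !mulr_ge0 // ltW.
  lra.
have leb : b%:R <= (1 - eps) * N.
  case: alt => [bias | [] //].
  have : 0 <= b%:R * x / a%:R by rewrite divr_ge0 ?mulr_ge0 // ltW.
  have : b%:R + b%:R * x / a%:R <= (1 - eps) * N.
    have -> : b%:R + b%:R * x / a%:R = b%:R * (a%:R + x) / a%:R by field; rewrite gt_eqF.
    rewrite ler_pdivrMr //.
    move: bias; rewrite mulrA ler_pdivlMr; last by lra.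
    by rewrite mulrA mulrAC.
  lra.
have Cx : 0 <= C * x by rewrite mulr_ge0 // ltW.
(* A larger [a] is cut down to about [C * ln n]. The summand 1 in [C] absorbs the rounding, so ln n
   / a' stays below [eps / 2], and (1 - eps) (1 + eps / 2) <= 1 - eps / 2. *)
pose a' := Num.truncn (C * x).
have /andP[lea' lta'] : a'%:R <= C * x < a'.+1%:R by apply: truncn_itv.
have le2 : 2 / eps * x <= a'%:R.
  move: lta'; rewrite -natr1 /C mulrDl mul1r; lra.
have a'_gt0 : 0 < a'%:R :> R.
  by apply: lt_le_trans le2; rewrite mulr_gt0 // divr_gt0.
apply: (win a a') => //.
  rewrite -(ltr0n R) a'_gt0 -(ler_nat R).
  by apply: le_trans lea' _; apply: ltW.
have le_eps : x / a'%:R <= eps / 2.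
  rewrite ler_pdivrMr //; have := ler_wpM2l (ltW eps_gt0) le2.
  have -> : eps * (2 / eps * x) = 2 * x by field; rewrite gt_eqF.
  lra.
have b_ge0 : 0 <= b%:R :> R by [].
apply: (@le_trans _ _ (b%:R * (1 + eps / 2))); first by rewrite ler_wpM2l // lerD2l.
have : b%:R * (1 + eps / 2) <= (1 - eps) * N * (1 + eps / 2).
  by rewrite ler_wpM2r //; lra.
have : 0 <= eps ^+ 2 * N by rewrite mulr_ge0 // sqr_ge0.
rewrite expr2; lra.
Qed.

(** Comparison of the sum with an integral, term by term; [q%:R] pays for the [q] roundings. *)
Lemma sum_divn_ge a b q : (0 < a)%N ->
  b%:R / a%:R * (ln (1 + a%:R * q.+1%:R) - ln (1 + a%:R)) <=
  (\sum_(1 <= m < q.+1) b %/ (1 + a * m))%:R + q%:R :> R.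
Proof.
move=> a_gt0; have a_gt0R : 0 < a%:R :> R by rewrite ltr0n.
elim: q => [|q IHq]; first by rewrite mulr1 subrr mulr0 big_geq.
rewrite big_nat_recr //= natrD.
set r : R := 1 + a%:R * q.+1%:R in IHq *.
have r_gt0 : 0 < r by rewrite addr_gt0 ?mulr_gt0.
have le_inc : b%:R / a%:R * (ln (1 + a%:R * q.+2%:R) - ln r) <= b%:R / r.
  have := ln_increment_le _ _ r_gt0 (ltW a_gt0R).
  have -> : r + a%:R = 1 + a%:R * q.+2%:R by rewrite /r -[q.+2%:R]natr1; ring.
  have ba : 0 <= b%:R / a%:R :> R by rewrite divr_ge0.
  move/(ler_wpM2l ba); rewrite [leRHS](_ : _ = b%:R / r) //.
  by field; rewrite !gt_eqF.
have le_div : b%:R / r <= (b %/ (1 + a * q.+1))%:R + 1.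
  rewrite ler_pdivrMr // natr1.
  have -> : r = (1 + a * q.+1)%:R by rewrite /r natrD natrM.
  by rewrite -natrM ler_nat ltnW // ltn_ceil.
have : q.+1%:R = q%:R + 1 :> R by rewrite natr1.
move: IHq le_inc; rewrite !mulrBr.
lra.
Qed.

(** One crude bound for both room conditions of [breaker_wins_of_boxes]. *)
Lemma room_bounds a q : (0 < a)%N -> (0 < q)%N ->
  (a.+1 * (a * q + a.+1) <= 6 * a ^ 2 * q)%N /\
  (2 * (a * (a * q)) + a * q + a.+1 <= 6 * a ^ 2 * q)%N.
Proof.
move=> a_gt0 q_gt0; have le_aq : (a <= a * q)%N by rewrite leq_pmulr.
have le_aaq : (a * q <= a * (a * q))%N by rewrite leq_pmull.
have -> : (6 * a ^ 2 * q = 6 * (a * (a * q)))%N by ring.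
split; last lia.
have : (a * a <= a * (a * q))%N by rewrite leq_mul2l le_aq orbT.
lia.
Qed.

Lemma breaker_wins_above_threshold eps : 0 < eps -> eps <= 1 / 2 ->
  exists n0, forall n, (n0 <= n)%N -> forall a b, (0 < a)%N ->
    (1 + eps) * (a%:R * n%:R / (a%:R + ln (n%:R : R))) <= b%:R ->
    breaker_wins_connectivity n a b.
Proof.
move=> eps_gt0 eps_le.
(* The second summand makes y^3 / 6, a lower bound for n^(eps / 2), exceed 72 x^2 / eps^2 where x =
   2 y / eps; the third ensures [12 <= eps * E]. *)
pose Y := 1 + 24 * 72 / eps ^+ 4 + 24 / eps.
have Y1 : 0 <= 24 * 72 / eps ^+ 4 by rewrite divr_ge0 ?mulr_ge0 ?exprn_ge0 // ltW.
have Y2 : 0 <= 24 / eps by rewrite divr_ge0 // ltW.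
have [n0 n0P] := ln_natr_large (2 * Y / eps).
exists n0 => n /n0P; set x := ln _ => leYx a b a_gt0 bias.
have a_gt0R : 0 < a%:R :> R by rewrite ltr0n.
have le1a : 1 <= a%:R :> R by rewrite ler1n.
pose y := eps / 2 * x.
have leYy : Y <= y by move: leYx; rewrite ler_pdivrMr // /y; lra.
have y_gt1 : 1 <= y by move: leYy; rewrite /Y; lra.
have Ex : x = 2 / eps * y by rewrite /y; field; rewrite gt_eqF.
have leyx : 2 * y <= x.
  rewrite Ex ler_wpM2r //; first lra.
  by rewrite ler_pdivlMr //; lra.
have x_gt0 : 0 < x by lra.
have Nx : expR x = n%:R by apply: expR_ln_natr.
set N : R := n%:R in Nx bias *.
have N_gt1 : 1 < N by rewrite -Nx expR_gt1.
have n_gt1 : (1 < n)%N by rewrite -(ltr1n R).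
(* If [b >= n - 1], Breaker isolates a vertex immediately. Otherwise [b < n], and the bias forces
   [eps * a <= ln n]. *)
have [lenb|ltbn] := leqP n b.+1.
  by apply: (@breaker_wins_of_boxes n a b 0) => //; rewrite big_geq // addn0.
have bN : b%:R < N by rewrite ltr_nat ltnW.
have b_ge0 : 0 <= b%:R :> R by [].
rewrite mulrA ler_pdivrMr in bias; last lra.
have leax : eps * a%:R <= x.
  have : (1 + eps) * a%:R * N <= (a%:R + x) * N.
    rewrite -mulrA; apply: le_trans bias _; rewrite mulrC ler_wpM2l ?ltW //; lra.
  rewrite ler_pM2r; [lra | lra].
(* [E] is n^(eps / 2) and [z] is n^(1 - eps / 2). *)
pose E := expR y; pose z := expR (x - y).
have zE : z * E = N by rewrite -expRD subrK.
have E_gt0 : 0 < E := expR_gt0 y.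
have z_gt1 : 1 <= z by rewrite -expR0 ler_expR; lra.
have E3 : y ^+ 3 / 6 <= E.
  by have := expR_ge_expr y 2; rewrite (_ : 3`!%:R = 6) //; apply; lra.
have E1 : y <= E by apply: le_trans (expR_ge1Dx y); lra.
have E12 : 12 <= eps * E.
  have : 24 / eps <= y by move: leYy; rewrite /Y; lra.
  rewrite ler_pdivrMr // => le24.
  have : y * eps <= E * eps by rewrite ler_wpM2r // ltW.
  lra.
have E36 : 72 * x ^+ 2 <= eps ^+ 2 * E.
  have e4 : 0 < eps ^+ 4 by rewrite exprn_gt0.
  have : 24 * 72 / eps ^+ 4 <= y by move: leYy; rewrite /Y; lra.
  rewrite ler_pdivrMr // => le1.
  have e2 : 0 < eps ^+ 2 by rewrite exprn_gt0.
  rewrite -(ler_pM2r e2).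
  have -> : 72 * x ^+ 2 * eps ^+ 2 = 288 * y ^+ 2.
    by rewrite Ex; field; rewrite gt_eqF.
  have : 24 * 72 * y ^+ 2 <= y * eps ^+ 4 * y ^+ 2 by rewrite ler_wpM2r // sqr_ge0.
  have : y ^+ 3 / 6 * eps ^+ 4 <= E * eps ^+ 4 by rewrite ler_wpM2r // ltW.
  have -> : eps ^+ 2 * E * eps ^+ 2 = E * eps ^+ 4 by ring.
  have -> : y * eps ^+ 4 * y ^+ 2 = y ^+ 3 * eps ^+ 4 by ring.
  lra.
(* Above [2 * z], so that [1 + a * q.+1] is at least [z * (1 + a)] and the logarithms differ by at
   least [x - y]; below [3 * z], to bound the rounding loss. *)
pose q := (Num.truncn (2 * z)).+1.
have q_gt : 2 * z < q%:R by apply: truncnS_gt.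
have q_le : q%:R <= 3 * z.
  have : (Num.truncn (2 * z))%:R <= 2 * z by rewrite truncn_le; lra.
  by rewrite -[q%:R]natr1; lra.
have aax : eps ^+ 2 * a%:R ^+ 2 <= x ^+ 2.
  by rewrite -exprMn lerXn2r ?nnegrE ?mulr_ge0 //; apply: ltW.
have e2 : 0 < eps ^+ 2 by rewrite exprn_gt0.
have q0R : 0 <= q%:R :> R by [].
have aq : 6 * a%:R ^+ 2 * q%:R <= 18 * a%:R ^+ 2 * z.
  have : a%:R ^+ 2 * q%:R <= a%:R ^+ 2 * (3 * z) by rewrite ler_wpM2l ?sqr_ge0.
  lra.
have a2E : 18 * a%:R ^+ 2 <= E.
  by rewrite -(ler_pM2l e2); have := sqr_ge0 x; lra.
have z_gt0 : 0 < z := expR_gt0 _.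
apply: (@breaker_wins_of_boxes n a b q) => //.
  have [room_edges room_vertices] := room_bounds a q a_gt0 (ltn0Sn _).
  move=> _; split.
    apply: leq_trans room_edges _.
    rewrite -(ler_nat R) 2!natrM natrX; apply: le_trans aq _.
    have aN : eps * (a%:R * (z * E)) <= b%:R * (2 * x).
      have : eps * (a%:R + x) <= 2 * x.
        have : eps * x <= x by rewrite -[leRHS]mul1r ler_wpM2r //; lra.
        lra.
      move=> /(ler_wpM2l b_ge0); apply: le_trans.
      rewrite [leRHS]mulrCA ler_pM2l // zE; apply: le_trans bias.
      rewrite -[leLHS]mul1r ler_wpM2r ?mulr_ge0 //; lra.
    have aE : 36 * (a%:R * x) <= eps * E.
      rewrite -(ler_pM2l eps_gt0).
      have : eps * a%:R * x <= x * x by rewrite ler_wpM2r // ltW.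
      by move: E36 (sqr_ge0 x); rewrite !expr2; lra.
    have x2 : 0 < 2 * x by lra.
    rewrite -(ler_pM2r x2); apply: le_trans aN.
    have -> : 18 * a%:R ^+ 2 * z * (2 * x) = (a%:R * z) * (36 * (a%:R * x)) by ring.
    have -> : eps * (a%:R * (z * E)) = (a%:R * z) * (eps * E) by ring.
    by rewrite ler_wpM2l // mulr_ge0 // ltW.
  apply: leq_trans room_vertices _.
  rewrite -(ler_nat R) 2!natrM natrX; apply: le_trans aq _.
  have : 18 * a%:R ^+ 2 * z <= E * z by rewrite ler_wpM2r // ltW.
  by rewrite [E * z]mulrC zE.
rewrite -(ler_nat R) -natr1 natrD; set sum := (\sum_(_ <= _ < _) _)%:R.
have sum_ge : b%:R / a%:R * (x - y) <= sum + q%:R.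
  apply: le_trans (sum_divn_ge a b q a_gt0).
  rewrite ler_wpM2l ?divr_ge0 // -ln_div ?posrE ?addr_gt0 ?mulr_gt0 //.
  rewrite -[x - y]expRK ler_ln ?posrE ?expR_gt0 ?divr_gt0 ?addr_gt0 ?mulr_gt0 //.
  rewrite -/z ler_pdivlMr ?addr_gt0 // -natr1.
  have : z <= a%:R * z by rewrite -[leLHS]mul1r ler_wpM2r // ltW.
  have : a%:R * (2 * z) <= a%:R * q%:R by rewrite ler_wpM2l // ltW.
  lra.
(* Here [eps <= 1 / 2] enters: it gives (1 - eps / 2) (1 + eps) >= 1 + eps / 4. *)
have main : (1 + eps / 4) * N <= b%:R + b%:R / a%:R * (x - y).
  rewrite -(ler_pM2r a_gt0R).
  have -> : (b%:R + b%:R / a%:R * (x - y)) * a%:R = b%:R * (a%:R + (1 - eps / 2) * x).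
    by rewrite /y; field; rewrite gt_eqF.
  apply: (@le_trans _ _ ((1 - eps / 2) * (b%:R * (a%:R + x)))).
    have eps2 : 0 <= 1 - eps / 2 by lra.
    apply: le_trans (ler_wpM2l eps2 bias).
    have aN : 0 <= a%:R * N by rewrite mulr_ge0 //; lra.
    have -> : (1 + eps / 4) * N * a%:R = (1 + eps / 4) * (a%:R * N) by ring.
    rewrite [leRHS](_ : _ = (1 - eps / 2) * (1 + eps) * (a%:R * N)); last by ring.
    by rewrite ler_wpM2r //; nra.
  rewrite mulrCA ler_wpM2l //.
  have : 0 <= eps * a%:R by rewrite mulr_ge0 // ltW.
  lra.
(* The rounding loss [q <= 3 * z] is thus at most [eps / 4 * N], the surplus provided by [main]. *)
have : z * 12 <= z * (eps * E) by rewrite ler_wpM2l // ltW.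
rewrite mulrCA zE.
lra.
Qed.

(** Since n >= (ln n)^4 / 24, the root of n / ln n is at least of order (ln n)^(3/2) and outgrows
    every multiple of ln n. *)
Lemma Omega_sqrt_natr_div_ln (a : nat -> nat) C : 0 <= C ->
  (fun n => (a n)%:R : R^o) =Omega_\oo (fun n => Num.sqrt (n%:R / ln n%:R) : R^o) ->
  exists n0, forall n, (n0 <= n)%N -> C * ln (n%:R : R) < (a n)%:R.
Proof.
move=> C_ge0; rewrite eqOmegaE qualifE => /asboolP[k k_gt0 [n1 _ aP]].
pose c := (C + 1) / k; have c_ge0 : 0 <= c by rewrite divr_ge0 ?(ltW k_gt0) //; lra.
have [n2 n2P] := ln_natr_large (1 + 24 * c ^+ 2).
exists (maxn n1 n2) => n; rewrite geq_max => /andP[/aP /= le_a /n2P].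
set x := ln _ in le_a * => lex.
have c2 : 0 <= c ^+ 2 := sqr_ge0 c.
have x_gt0 : 0 < x by lra.
have le_c : (c * x) ^+ 2 <= n%:R / x.
  rewrite ler_pdivlMr //; have := expR_ge_expr x 3 (ltW x_gt0).
  rewrite expR_ln_natr //; apply: le_trans.
  have -> : 4`!%:R = 24 :> R by [].
  have : 24 * c ^+ 2 * x ^+ 3 <= x * x ^+ 3.
    by rewrite ler_wpM2r ?exprn_ge0 ?(ltW x_gt0) //; lra.
  have -> : (c * x) ^+ 2 * x = c ^+ 2 * x ^+ 3 by ring.
  have -> : x ^+ 4 = x * x ^+ 3 by ring.
  lra.
have le_sqrt : c * x <= Num.sqrt (n%:R / x).
  rewrite -[c * x]ger0_norm; last by rewrite mulr_ge0 // ltW.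
  by rewrite -sqrtr_sqr ler_wsqrtr.
move: le_a; rewrite !ger0_norm ?sqrtr_ge0 //; apply: lt_le_trans.
apply: (@lt_le_trans _ _ (k * (c * x))); last by rewrite ler_wpM2l // ltW.
have -> : k * (c * x) = (C + 1) * x by rewrite /c; field; rewrite gt_eqF.
by rewrite ltr_pM2r //; lra.
Qed.

End Asymptotics.

Theorem theorem15 (R : realType) (a : nat -> nat) (a_gt0 : forall n, (0 < a n)%N) :
  ((fun n => (a n)%:R : R^o) =o_\oo (fun n => Num.sqrt (n%:R / ln n%:R) : R^o) ->
     asymptotically_optimal_threshold_bias a
       (fun n => (a n)%:R * n%:R / ((a n)%:R + ln n%:R) : R)) /\
  ((fun n => (a n)%:R : R^o) =Omega_\oo (fun n => Num.sqrt (n%:R / ln n%:R) : R^o) ->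
     asymptotically_optimal_threshold_bias a (fun n => n%:R : R)).
Proof.
split=> [_|a_Omega] eps eps_gt0; have [n1 n1P] := maker_wins_below_threshold R eps eps_gt0.
  (* Breaker's estimate is for [e <= 1 / 2]; a smaller [e] only weakens what it demands of [b]. *)
  pose e := Num.min eps (1 / 2).
  have e_gt0 : 0 < e by rewrite lt_min eps_gt0 /=; lra.
  have e_le : e <= 1 / 2 by rewrite ge_min lexx orbT.
  have [n2 n2P] := breaker_wins_above_threshold R e e_gt0 e_le.
  exists (maxn n1 (maxn n2 1)) => n; rewrite !geq_max => /and3P[/n1P winM /n2P winB n_gt0].
  split=> b hb; first by move=> bias; apply: winM => //; left.
  apply: winB => //; apply: le_trans hb; rewrite ler_wpM2r //.
    by rewrite divr_ge0 // addr_ge0 // ln_ge0 // ler1n.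
  by rewrite lerD2l ge_min lexx.
have C_ge0 : 0 <= 2 / eps + 1 by rewrite addr_ge0 // divr_ge0 // ltW.
have [n2 n2P] := Omega_sqrt_natr_div_ln R a (2 / eps + 1) C_ge0 a_Omega.
exists (maxn n1 (maxn n2 2)) => n; rewrite !geq_max => /and3P[/n1P winM /n2P large n_gt1].
split=> b hb; first by move=> bias; apply: winM => //; right.
(* With [b >= n] Breaker takes a full star in his first move. *)
apply: (@breaker_wins_of_boxes n (a n) b 0) => //; rewrite big_geq // addn0.
apply: ltnW; rewrite ltnS -(ler_nat R); apply: le_trans hb.
by rewrite -[leLHS]mul1r ler_wpM2r //; lra.
Qed.
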